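(* Let $l=9$, $r\in\{1,2,4\}$ and $a=[r]$. Then $p_{32,12}(1/a)$ and $p_{128,48}(1/a)$ are in $S$.
   Context: For an integer $i$, $[i]=\sum x^{n^2}\in\mathbb{Z}/2[[x]]$, summed over $n\in\mathbb{Z}$ with $n\equiv i\pmod 9$. $S$ is the subring of $\mathbb{Z}/2[[x]]$ generated over $\mathbb{Z}/2$ by $[1],[2],[3],[4]$. $1/a$ is taken in the field $L$ of Laurent series over $\mathbb{Z}/2$. For $q$ a power of $2$ and $0\le j<q$, $p_{q,j}:L\to L$ is $\sum_n c_nx^n\mapsto\sum_{n\equiv j\pmod q}c_nx^n$. *)

(* Defs.v *)
From HB Require Import structures.
From mathcomp Require Import all_boot all_order all_algebra.
From mathcomp Require Import finmap.
From mathcomp Require Import boolp classical_sets functions cardinality fsbigop.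
From mathcomp Require Import zify.

Set Implicit Arguments.
Unset Strict Implicit.
Unset Printing Implicit Defensive.

Import Order.TTheory GRing.Theory Num.Theory.

Local Open Scope classical_set_scope.
Local Open Scope ring_scope.

Section Laurent.
Variable K : fieldType.
Implicit Types (f g h : int -> K) (N M n : int) (m B : nat).

Definition low N f := forall n, n < N -> f n = 0.

(* Formal Laurent series over K: the coefficient of x^n is lcoef n. *)
Record laurent := Laurent {
  lcoef : int -> K;
  lcoef_bounded : `[< exists N, low N lcoef >] }.

HB.instance Definition _ := [isSub for lcoef].
HB.instance Definition _ := [Choice of laurent by <:].

Lemma lcoefP (a : laurent) : exists N, low N (lcoef a).
Proof. exact/asboolP/lcoef_bounded. Qed.

Lemma laurentP (a b : laurent) : lcoef a =1 lcoef b <-> a = b.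
Proof. by split=> [/funext ab|->//]; apply: val_inj. Qed.

Lemma low_le N M f : N <= M -> low M f -> low N f.
Proof. by move=> NM fM n nN; apply: fM; exact: lt_le_trans nN NM. Qed.

Definition mk_laurent f (fP : exists N, low N f) : laurent :=
  Laurent (asboolT fP).

Fact lzero_bounded : exists N, low N (fun=> 0).
Proof. by exists 0. Qed.
Definition lzero := mk_laurent lzero_bounded.

Fact ladd_bounded (a b : laurent) : exists N, low N (fun n => lcoef a n + lcoef b n).
Proof.
have [[N aN] [M bM]] := (lcoefP a, lcoefP b); exists (Num.min N M) => n.
by rewrite lt_min => /andP[nN nM]; rewrite aN ?bM ?addr0.
Qed.
Definition ladd a b := mk_laurent (ladd_bounded a b).

Fact lopp_bounded (a : laurent) : exists N, low N (fun n => - lcoef a n).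
Proof. by have [N aN] := lcoefP a; exists N => n nN; rewrite aN ?oppr0. Qed.
Definition lopp a := mk_laurent (lopp_bounded a).

Fact laddA : associative ladd.
Proof. by move=> a b c; apply/laurentP => n /=; rewrite addrA. Qed.
Fact laddC : commutative ladd.
Proof. by move=> a b; apply/laurentP => n /=; rewrite addrC. Qed.
Fact ladd0 : left_id lzero ladd.
Proof. by move=> a; apply/laurentP => n /=; rewrite add0r. Qed.
Fact laddN : left_inverse lzero lopp ladd.
Proof. by move=> a; apply/laurentP => n /=; rewrite addNr. Qed.

HB.instance Definition _ := GRing.isZmodule.Build laurent laddA laddC ladd0 laddN.

(* All but finitely many terms vanish when f and g are bounded below. *)
Definition conv f g n : K := \sum_(i \in [set: int]) f i * g (n - i).

Lemma conv_low N M f g : low N f -> low M g -> low (N + M) (conv f g).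
Proof.
move=> fN gM n nNM; rewrite /conv fsbig1// => i _.
have [iN|Ni] := ltP i N; first by rewrite fN ?mul0r.
by rewrite gM ?mulr0//; lia.
Qed.

Definition trunc N B f : {poly K} := \poly_(k < B) f (N + k%:Z).

Lemma conv_trunc N M B m f g : low N f -> low M g -> (m < B)%N ->
  conv f g (N + M + m%:Z) = (trunc N B f * trunc M B g)`_m.
Proof.
move=> fN gM mB; rewrite coefM /conv.
pose A := [fset (N + (k : nat)%:Z)%R | k in [seq val k | k <- enum 'I_m.+1]]%fset.
rewrite (fsbigTE A) => [|i]; last first.
  move=> iA; have [iN|Ni] := ltP i N; first by rewrite fN ?mul0r.
  rewrite [X in _ * X]gM ?mulr0//; apply: contraNT iA; rewrite -leNgt => iM.
  apply/imfsetP; exists `|i - N|%N => /=; last by lia.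
  have im : (`|i - N| < m.+1)%N by lia.
  by apply/mapP; exists (Ordinal im); rewrite ?mem_enum.
rewrite big_imfset /=; last by move=> i j _ _; lia.
have -> : [seq nat_of_ord k | k <- enum 'I_m.+1] = iota 0 m.+1 by rewrite val_enum_ord.
rewrite undup_id ?iota_uniq//.
rewrite -[iota 0 _]/(index_iota 0 m.+1) big_mkord; apply: eq_bigr => k _.
have := ltn_ord k; rewrite ltnS => km.
rewrite !coef_poly (leq_ltn_trans km mB) (leq_ltn_trans (leq_subr _ _) mB).
by congr (_ * g _); lia.
Qed.

Fact lmul_bounded (a b : laurent) : exists N, low N (conv (lcoef a) (lcoef b)).
Proof.
have [[N aN] [M bM]] := (lcoefP a, lcoefP b).
by exists (N + M); exact: conv_low.
Qed.
Definition lmul a b := mk_laurent (lmul_bounded a b).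

Lemma eq_low N f g : low N f -> low N g ->
  (forall m, f (N + m%:Z) = g (N + m%:Z)) -> f =1 g.
Proof.
move=> fN gN fg n; have [nN|Nn] := ltP n N; first by rewrite fN ?gN.
by have := fg `|n - N|%N; congr (f _ = g _); lia.
Qed.

Lemma coefM_low (p q p' q' : {poly K}) m :
    (forall k, (k <= m)%N -> p`_k = p'`_k) ->
    (forall k, (k <= m)%N -> q`_k = q'`_k) -> (p * q)`_m = (p' * q')`_m.
Proof.
move=> pp' qq'; rewrite !coefM; apply: eq_bigr => k _.
by rewrite pp' ?qq' ?leq_subr// -ltnS.
Qed.

Fact lmulC : commutative lmul.
Proof.
move=> a b; have [[N aN] [M bM]] := (lcoefP a, lcoefP b).
apply/laurentP/(@eq_low (N + M)) => [||m] /=; first exact: conv_low.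
  by rewrite addrC; apply: conv_low.
rewrite (@conv_trunc _ _ m.+1)// mulrC -(@conv_trunc _ _ m.+1)//.
by congr conv; lia.
Qed.

Fact lmulA : associative lmul.
Proof.
move=> a b c.
have [[N aN] [M bM] [P cP]] := And3 (lcoefP a) (lcoefP b) (lcoefP c).
have abL := conv_low aN bM; have bcL := conv_low bM cP.
apply/laurentP/(@eq_low (N + (M + P))) => [||m] /=; first exact: conv_low.
  by rewrite addrA; exact: conv_low.
rewrite (@conv_trunc _ _ m.+1)// addrA (@conv_trunc _ _ m.+1)//.
rewrite (@coefM_low _ _ (trunc N m.+1 (lcoef a))
           (trunc M m.+1 (lcoef b) * trunc P m.+1 (lcoef c)))//; last first.
  by move=> k km; rewrite coef_poly ltnS km (@conv_trunc _ _ m.+1).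
rewrite mulrA; apply: coefM_low => // k km.
by rewrite coef_poly ltnS km (@conv_trunc _ _ m.+1).
Qed.

Fact lmulDl : left_distributive lmul ladd.
Proof.
move=> a b c.
have [[N aN] [M bM] [P cP]] := And3 (lcoefP a) (lcoefP b) (lcoefP c).
pose Q := Num.min N M.
have aQ : low Q (lcoef a) by apply: low_le aN; rewrite ge_min lexx.
have bQ : low Q (lcoef b) by apply: low_le bM; rewrite ge_min lexx orbT.
have abQ : low Q (fun n => lcoef a n + lcoef b n).
  by move=> n nQ; rewrite aQ ?bQ ?addr0.
apply/laurentP/(@eq_low (Q + P)) => [||m] /=; first exact: conv_low.
  by move=> n nQP; rewrite !(@conv_low Q P)// addr0.
rewrite !(@conv_trunc Q P m.+1)// -coefD -mulrDl.
by apply: coefM_low => // k km; rewrite coefD !coef_poly ltnS km.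
Qed.

Fact lone_bounded : exists N, low N (fun n => (n == 0)%:R).
Proof. by exists 0 => n n0; rewrite lt_eqF. Qed.
Definition lone := mk_laurent lone_bounded.

Lemma lone_low : low 0 (lcoef lone).
Proof. by move=> n n0 /=; rewrite lt_eqF. Qed.

Fact lmul1 : left_id lone lmul.
Proof.
move=> a; have [N aN] := lcoefP a.
have aN' : low (0 + N) (lcoef a) by rewrite add0r.
apply/laurentP/(@eq_low (0 + N)) => // [|m] /=; first exact: (conv_low lone_low).
rewrite (@conv_trunc 0 N m.+1)//; last exact: lone_low.
rewrite (@coefM_low _ _ 1 (trunc N m.+1 (lcoef a)))// => [|k km].
  by rewrite mul1r coef_poly ltnSn add0r.
by rewrite coef_poly ltnS km coef1 add0r.
Qed.

Fact lone_neq0 : lone != lzero.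
Proof.
by apply/eqP => /laurentP/(_ 0)/eqP; rewrite /= oner_eq0.
Qed.

HB.instance Definition _ :=
  GRing.Zmodule_isComNzRing.Build laurent lmulA lmulC lmul1 lmulDl lone_neq0.

Lemma lcoef0 n : lcoef (0 : laurent) n = 0. Proof. by []. Qed.
Lemma lcoef1 n : lcoef (1 : laurent) n = (n == 0)%:R. Proof. by []. Qed.
Lemma lcoefD (a b : laurent) n : lcoef (a + b) n = lcoef a n + lcoef b n.
Proof. by []. Qed.
Lemma lcoefN (a : laurent) n : lcoef (- a) n = - lcoef a n. Proof. by []. Qed.
Lemma lcoefM (a b : laurent) n :
  lcoef (a * b) n = \sum_(i \in [set: int]) lcoef a i * lcoef b (n - i).
Proof. by []. Qed.

(* The first m coefficients of the reciprocal of a power series with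
   coefficients u and constant term u 0 != 0. *)
Fixpoint inv_coefs (u : nat -> K) m : seq K :=
  if m is m'.+1 then
    let s := inv_coefs u m' in
    rcons s (((m' == 0%N)%:R - \sum_(j < m') u (m' - j)%N * s`_j) / u 0%N)
  else [::].

Lemma size_inv_coefs u m : size (inv_coefs u m) = m.
Proof. by elim: m => //= m IH; rewrite size_rcons IH. Qed.

Lemma nth_inv_coefs u m k : (k < m)%N ->
  (inv_coefs u m)`_k = (inv_coefs u k.+1)`_k.
Proof.
elim: m => // m IH; rewrite ltnS leq_eqVlt => /predU1P[->//|km].
by rewrite [inv_coefs u m.+1]/= nth_rcons size_inv_coefs km IH.
Qed.

Lemma inv_coefsE u m : u 0%N != 0 ->
  \sum_(j < m.+1) u (m - j)%N * (inv_coefs u j.+1)`_j = (m == 0%N)%:R.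
Proof.
move=> u0; rewrite big_ord_recr /= subnn nth_rcons size_inv_coefs ltnn eqxx.
rewrite [u 0%N * _]mulrC divfK// addrC.
under [X in _ - X + _]eq_bigr => j _ do rewrite nth_inv_coefs//.
by rewrite subrK.
Qed.

Lemma laurent_has_inv (a : laurent) : a != 0 -> exists b, b * a = 1.
Proof.
move=> a0; have [M aM] := lcoefP a.
have [k0 ak0] : exists k, lcoef a (M + (k : nat)%:Z) != 0.
  apply: contrapT => /forallNP a0'; case/eqP: a0; apply/laurentP.
  by apply: (@eq_low M) => // k; apply/eqP/contraT => /a0'.
pose exk : exists k, lcoef a (M + (k : nat)%:Z) != 0 := ex_intro _ k0 ak0.
case: (ex_minnP exk) => k ak kmin.
pose N : int := M + k%:Z.
have aN : low N (lcoef a).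
  move=> n nN; have [nM|Mn] := ltP n M; first exact: aM.
  apply/eqP/contraT => an; have := kmin `|n - M|%N.
  have -> : M + `|n - M|%N%:Z = n by lia.
  by move=> /(_ an); rewrite /N in nN; lia.
pose u i := lcoef a (N + (i : nat)%:Z).
have u0 : u 0%N != 0 by rewrite /u addr0.
pose v n := if n < - N then 0 else (inv_coefs u (absz (n + N)).+1)`_(absz (n + N)).
have vN : low (- N) v by move=> n nN; rewrite /v nN.
exists (mk_laurent (ex_intro (fun N => low N v) _ vN)).
apply/laurentP/(@eq_low (- N + N)) => [||m].
- exact: conv_low.
- by rewrite addNr; exact: lone_low.
rewrite [LHS](@conv_trunc (- N) N m.+1)// lcoef1 addNr add0r.
rewrite coefM -[RHS](inv_coefsE m u0); apply: eq_bigr => j _.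
rewrite !coef_poly ltn_ord ltnS leq_subr mulrC; congr (_ * _).
rewrite /= /v ltNge lerDl /=.
by have -> : absz (- N + j%:Z + N) = j by lia.
Qed.

Definition linv (a : laurent) : laurent := xget 0 [set b | b * a = 1].

Fact lmulV a : a != 0 -> linv a * a = 1.
Proof. by move=> /laurent_has_inv ab; exact: (xgetPex 0 ab). Qed.

Fact linv0 : linv 0 = 0.
Proof. by apply: xgetPN => b /= /esym/eqP; rewrite mulr0 oner_eq0. Qed.

HB.instance Definition _ := GRing.ComNzRing_isField.Build laurent lmulV linv0.

(* sect q j is p_{q,j}, keeping the exponents congruent to j modulo q. *)
Fact sect_bounded (q j : nat) (a : laurent) :
  exists N, low N (fun n => if (n == j %[mod q])%Z then lcoef a n else 0).
Proof. by have [N aN] := lcoefP a; exists N => n nN; rewrite aN ?if_same. Qed.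

Definition sect (q j : nat) (a : laurent) : laurent :=
  mk_laurent (sect_bounded q j a).

End Laurent.

(* The coefficient of x^m in [i]: the number modulo 2 of integers
   n = i (mod 9) with n^2 = m, a sum with at most two nonzero terms. *)
Definition theta_coef (i m : int) : 'F_2 :=
  \sum_(n \in [set n : int | (n = i %[mod 9])%Z]) ((m == n ^+ 2)%:R : 'F_2).

Fact theta_bounded (i : int) : exists N, low N (theta_coef i).
Proof.
exists 0 => m m0; rewrite /theta_coef fsbig1// => n _.
by rewrite lt_eqF//; apply: lt_le_trans m0 (sqr_ge0 n).
Qed.

Definition theta (i : int) : laurent 'F_2 := mk_laurent (theta_bounded i).

Lemma lcoef_theta_sqr (i : int) : ~~ (9%:Z %| i)%Z -> lcoef (theta i) (i ^+ 2) = 1.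
Proof.
move=> i9; rewrite /= /theta_coef -(@fsbig_widen _ _ _ _ [set i]) ?fsbig_set1 ?eqxx//.
  by move=> n ->.
move=> n /= [ni] nNi; case: eqP => // /esym/eqP; rewrite eqf_sqr.
case/orP => /eqP nE; first by case: nNi.
by move: ni i9; rewrite nE; lia.
Qed.

Lemma theta_neq0 (i : int) : ~~ (9%:Z %| i)%Z -> theta i != 0.
Proof.
by move=> /lcoef_theta_sqr; apply: contra_eq_neq => ->; rewrite eq_sym oner_eq0.
Qed.

(* The ring S, viewed inside the field of Laurent series; it contains the
   constants because 'F_2 is a prime field. *)
Definition ringS : set (laurent 'F_2) :=
  smallest (fun A : set (laurent 'F_2) => subring_closed [in A])
    [set theta 1; theta 2; theta 3; theta 4].

(* Main.v *)
(* Write a = [i], b = [2i], c = [4i], d = [3i], and let o1, o2, o4, o3 be the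
   parts of odd exponent of a, b, c, d. Odd squares are 1 mod 8, and the even part
   of [2j] is [j]^4, so a = o1 + c^4, b = o2 + a^4, c = o4 + b^4, d = o3 + d^4.
   The substitution (m, n) -> (m + n, m - n) turns m^2 + n^2 into 2(m^2 + n^2) and
   yields [k+j]^2 [k-j]^2 = [k]^4 [j]^4 + o_{2k} o_{2j}; six instances of this give
   all the algebraic relations between a, b, c, d that are needed.

   Expanding 1/a = a^3/a^4 and c^3/a = (c a)^3/a^4 by residues of exponents modulo 4,
   the relations give p_{4,0}(1/a) = (c^3/a)^4 and p_{4,0}(c^3/a) = (G/a)^4, where
   G = d (a^2 b + b^2 c + c^2 a). Hence p_{32,12}(1/a) = p_{8,3}(c^3/a)^4 and
   p_{128,48}(1/a) = p_{8,3}(G/a)^16. The same expansion, now modulo 8, shows that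
   the denominators cancel:
     p_{8,3}(c^3/a) = o2 o3 o4 d^8,
     p_{8,3}(G/a) = o1 o2 o3 + o3 o4^2 + o1^2 o2 a^8. *)
From Stdlib Require Import PArith NArith Ring.
Require Import Defs.
From mathcomp Require Import all_boot all_order all_algebra.
From mathcomp Require Import boolp classical_sets.
From mathcomp Require Import functions cardinality fsbigop zify.

Set Implicit Arguments.
Unset Strict Implicit.
Unset Printing Implicit Defensive.

Import Order.TTheory GRing.Theory Num.Theory.
Local Open Scope classical_set_scope.
Local Open Scope ring_scope.

(** * Consequences of the theta relations in characteristic two *)

Section CharTwo.
Variable L : fieldType.
Hypothesis char2 : 1 + 1 = 0 :> L.

Lemma addLL (x : L) : x + x = 0.
Proof. by rewrite -mulr2n -mulr_natl mulr2n char2 mul0r. Qed.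

Lemma add_eq0 (x y : L) : x + y = 0 -> x = y.
Proof. by move=> xy; rewrite -[x]addr0 -(addLL y) addrA xy add0r. Qed.

(** * A decision procedure for polynomial identities modulo 2 *)

Let addL (x y : L) : L := x + y.
Let mulL (x y : L) : L := x * y.
Let expL (x : L) (n : nat) : L := x ^+ n.
Let zeroL : L := 0.
Let oneL : L := 1.
Let bitL (b : bool) : L := if b then 1 else 0.

Let L_ring : ring_theory zeroL oneL addL mulL addL id eq.
Proof.
by split=> *; [exact: add0r|exact: addrC|exact: addrA|exact: mul1r
  |exact: mulrC|exact: mulrA|exact: mulrDl|by []|exact: addLL].
Qed.

Let L_morph : ring_morph zeroL oneL addL mulL addL id eq
  false true xorb andb xorb id Bool.eqb bitL.
Proof.
by split=> //; do ?[case]; do ?[case];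
  rewrite /bitL /addL /mulL /zeroL /oneL /= ?(addr0, add0r, mulr0, mulr1, mul0r) ?char2.
Qed.

Let L_power : power_theory oneL mulL eq N.to_nat expL.
Proof.
rewrite /oneL /mulL /expL; split=> r [|p] //=.
elim: p => [p IH|p IH|] /=; rewrite ?Pnat.Pos2Nat.inj_xI ?Pnat.Pos2Nat.inj_xO ?expr1 // -IH.
  by rewrite -exprD -exprS; congr (_ ^+ _); lia.
by rewrite -exprD; congr (_ ^+ _); lia.
Qed.

Ltac bit_cst t := match t with
  | zeroL => constr:(false) | oneL => constr:(true)
  | _ => constr:(InitialRing.NotConstant) end.
Ltac nat_cst t := match isnatcst t with
  | true => constr:(N.of_nat t) | _ => constr:(InitialRing.NotConstant) end.

(* Coefficients are taken in bool with xor and and, so that Stdlib's ring computes modulo 2. *)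
Add Ring L_ring2 : L_ring (morphism L_morph, constants [bit_cst], power_tac L_power [nat_cst]).

(** The operations are first renamed to those declared to [ring], which recognizes them
    syntactically. *)
Ltac ring2 :=
  match goal with |- @eq _ ?x ?y => change (@eq L x y) end;
  repeat match goal with
  | |- context [@Algebra.add ?V] => change (@Algebra.add V) with addL
  | |- context [@GRing.mul ?V] => change (@GRing.mul V) with mulL
  | |- context [@GRing.exp ?V] => change (@GRing.exp V) with expL
  | |- context [@Algebra.zero ?V] => change (@Algebra.zero V) with zeroL
  | |- context [GRing.one ?V] => change (GRing.one V) with oneL
  end; ring.

(** * Polynomial relations between a, b, c, d and their consequences *)

Definition relA (a b c d : L) := a ^+ 2 * d ^+ 2 + b * c + b ^+ 5 + c * a ^+ 4.
Definition relB (a b c d : L) := b ^+ 2 * c ^+ 2 + b * d + b * d ^+ 4 + d * a ^+ 4.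
Definition relC (a b c d : L) :=
  c ^+ 8 + a * c ^+ 4 + d ^+ 6 * a ^+ 2 + d ^+ 4 * (b * c).

(** These are the six product formulas for pairs of odd parts, with o1 = a + c^4, o2 = b + a^4, o4 =
    c + b^4 and o3 = d + d^4 eliminated. *)
Definition theta_rels (a b c d : L) :=
  [/\ relA a b c d = 0, relA b c a d = 0 & relA c a b d = 0] /\
  [/\ relB a b c d = 0, relB b c a d = 0 & relB c a b d = 0].

(** The symmetry comes from replacing i by 2i: modulo 9, 8i = -i and 6i = -3i, so a, b, c are
    permuted cyclically and d is fixed. *)
Lemma theta_rels_cyc a b c d : theta_rels a b c d -> theta_rels b c a d.
Proof. by case=> -[? ? ?] [? ? ?]. Qed.

(* Only the multiple (d + 1) * relC, not relC itself, was found in the ideal of the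
   six relations; the cofactors come from linear algebra over F_2. *)
Lemma relC_eq0 a b c d : theta_rels a b c d -> d != 1 -> relC a b c d = 0.
Proof.
move=> [[A1 A2 A3] [B1 B2 B3]] d1.
have : (d + 1) * relC a b c d = 0.
  suff -> : (d + 1) * relC a b c d =
    (d ^+ 2 + d ^+ 4 + b * c ^+ 2 + a * b ^+ 2 * d + a ^+ 2 * c
      + a ^+ 2 * c * d) * relA a b c d +
    (c ^+ 3 + b ^+ 3 * d) * relA b c a d +
    (c + c * d ^+ 2 + b ^+ 4 + a * b ^+ 2 * c + a ^+ 2 * c ^+ 2) * relB a b c d +
    (b + b * d + b * d ^+ 2 + a ^+ 2 * b * c + a ^+ 4) * relB b c a d +
    (c ^+ 4 + b ^+ 3 * c + a * d ^+ 3) * relB c a b d.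
    by rewrite A1 A2 B1 B2 B3 !mulr0 !addr0.
  by rewrite /relA /relB /relC; ring2.
by move/eqP; rewrite mulf_eq0 => /orP[/eqP/add_eq0 dE|/eqP//]; rewrite dE eqxx in d1.
Qed.

Definition formG (a b c d : L) := d * (a ^+ 2 * b + b ^+ 2 * c + c ^+ 2 * a).
Definition formK (a b c d : L) := b ^+ 3 * d ^+ 3 + a * b * c * d + a * b ^+ 2 * c ^+ 3.
Definition relK a b c d := formK a b c d + formK b c a d.

(** [formK]^2 / a^4 arises below as p_{4,0}(c^3/a); this identity makes it the fourth power of G/a.
    The proof is an explicit ideal membership. *)
Lemma formG_sqr a b c d : theta_rels a b c d -> formG a b c d ^+ 2 = formK a b c d.
Proof.
move=> [[A1 A2 A3] [B1 B2 B3]]; apply: add_eq0.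
suff -> : formG a b c d ^+ 2 + formK a b c d =
    a ^+ 2 * b ^+ 2 * relA a b c d +
    (b * d ^+ 4 + a ^+ 4 * d) * relA b c a d +
    a ^+ 2 * c ^+ 2 * relA c a b d +
    (b ^+ 2 * d ^+ 2 + a * c) * relB a b c d +
    (b * c ^+ 4 + a * b + a ^+ 5) * relB b c a d +
    (b * c + b ^+ 5 + a ^+ 4 * c) * relB c a b d.
  by rewrite A1 A2 A3 B1 B2 B3 !mulr0 !addr0.
by rewrite /relA /relB /formG /formK; ring2.
Qed.

(** [formG] is invariant under the cyclic shift, whereas [formK] is so only modulo the relations. *)
Lemma relK_eq0 a b c d : theta_rels a b c d -> relK a b c d = 0.
Proof.
move=> rel; rewrite /relK -(formG_sqr rel) -(formG_sqr (theta_rels_cyc rel)).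
by rewrite /formG; ring2.
Qed.

(* After taking square roots and dividing by a^2, this is the identity [quartic_rel]
   that makes the denominator a^8 of p_{8,3}(G/a) cancel. *)
Definition relE (a b c d : L) :=
  (a * b + c ^+ 2 * d ^+ 2) * b ^+ 2 * (a * b ^+ 2 + d ^+ 4 + b * c ^+ 2) ^+ 2 +
  (d + d ^+ 4) * (a ^+ 2 * d ^+ 3 + b * c * d + c * a * b ^+ 3) ^+ 2 +
  a ^+ 6 * (c * d + c ^+ 2 * a ^+ 2).

(** Another explicit ideal membership, with [relC], [relK] and their cyclic images as further
    generators; d != 1 enters through [relC]. *)
Lemma relE_eq0 a b c d : theta_rels a b c d -> d != 1 -> relE a b c d = 0.
Proof.
move=> rel d1; have [[A1 A2 A3] [B1 B2 B3]] := rel.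
have rel' := theta_rels_cyc rel.
have C1 := relC_eq0 rel d1; have C2 := relC_eq0 rel' d1.
have C3 := relC_eq0 (theta_rels_cyc rel') d1.
have K1 := relK_eq0 rel; have K2 := relK_eq0 rel'.
suff -> : relE a b c d =
    (b * c * d ^+ 3 + b * c * d ^+ 4 + b * c * d ^+ 8 + a * b * c ^+ 6 * d
      + a ^+ 2 * d ^+ 4 + a ^+ 2 * b * c ^+ 2 + a ^+ 3 * c ^+ 5 * d ^+ 2
      + a ^+ 4 * c * d ^+ 5 + a ^+ 4 * b ^+ 4 * d ^+ 2) * relA a b c d +
    (b ^+ 4 * c * d ^+ 2 + a * b * d ^+ 3 + a * b ^+ 3 * c ^+ 4 * d ^+ 2
      + a ^+ 2 * b ^+ 3 * d ^+ 2 + a ^+ 2 * b ^+ 4 * c ^+ 2 * d ^+ 2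
      + a ^+ 3 * b * c * d ^+ 5 + a ^+ 3 * b ^+ 2 * c ^+ 3
      + a ^+ 7 * c * d ^+ 2) * relA b c a d +
    (b ^+ 2 * d ^+ 2 + b ^+ 2 * d ^+ 8 + a * c * d ^+ 2 + a * b * c ^+ 3 * d ^+ 3
      + a ^+ 2 * b ^+ 6 + a ^+ 3 * c ^+ 2 * d ^+ 5
      + a ^+ 3 * b * c ^+ 4 * d ^+ 2) * relA c a b d +
    (a * c ^+ 5 * d ^+ 3 + a * b ^+ 3 * c ^+ 2 * d ^+ 2 + a ^+ 2 * c + a ^+ 2 * c * d
      + a ^+ 2 * c * d ^+ 6 + a ^+ 2 * b * c ^+ 3 * d ^+ 2
      + a ^+ 3 * b ^+ 2 * c * d ^+ 3 + a ^+ 4 * c ^+ 2 * d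
      + a ^+ 4 * b * c ^+ 4 * d) * relB a b c d +
    (a * b * c ^+ 4 * d + a * b * c ^+ 4 * d ^+ 3 + a * b ^+ 4 * c * d
      + a * b ^+ 4 * c * d ^+ 2 + a * b ^+ 5 * c ^+ 3 * d + a ^+ 2 * b
      + a ^+ 2 * b * d ^+ 3 + a ^+ 2 * b ^+ 3 * c ^+ 4 * d + a ^+ 3 * b * c ^+ 5
      + a ^+ 3 * b * c ^+ 5 * d + a ^+ 3 * b ^+ 4 * c ^+ 2 * d) * relB b c a d +
    (b * c ^+ 5 * d ^+ 3 + b ^+ 3 * d + b ^+ 4 * c ^+ 2 * d ^+ 4 + a * b * c * d ^+ 2
      + a * b * c * d ^+ 6 + a * b ^+ 2 * c ^+ 3 + a * b ^+ 5 * d ^+ 2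
      + a * b ^+ 6 * c ^+ 2 + a ^+ 3 * d ^+ 5 + a ^+ 3 * d ^+ 6 + a ^+ 4 * b ^+ 2 * d
      + a ^+ 5 * b ^+ 4) * relB c a b d +
    (b * c * d ^+ 4 + a ^+ 2 * d ^+ 3 + a ^+ 3 * b ^+ 2 * d ^+ 2) * relC a b c d +
    c ^+ 2 * relC b c a d +
    (a * b * c ^+ 3 * d ^+ 2 + a ^+ 3 * c ^+ 2 + a ^+ 4 * b * d ^+ 2) * relC c a b d +
    (b * c ^+ 6 * d ^+ 2 + b ^+ 3 * c + b ^+ 3 * c * d ^+ 5 + a * b * c ^+ 2 * d ^+ 5
      + a * b ^+ 5 * c + a ^+ 2 * c ^+ 5 + a ^+ 2 * b ^+ 2 * d
      + a ^+ 2 * b ^+ 2 * d ^+ 3 + a ^+ 3 * c + a ^+ 3 * c * d) * relK a b c d +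
    (b * c ^+ 6 * d ^+ 2 + b ^+ 3 * c + a ^+ 3 * c * d) * relK b c a d.
  by rewrite A1 A2 A3 B1 B2 B3 C1 C2 C3 K1 K2 !mulr0 !addr0.
by rewrite /relA /relB /relC /relK /relE /formK; ring2.
Qed.

(** * Decompositions of 1/a, c^3/a and G/a by residues of exponents *)

Section System.
Variables a b c d o1 o2 o3 o4 : L.
Hypotheses (aE : a = o1 + c ^+ 4) (bE : b = o2 + a ^+ 4).
Hypotheses (cE : c = o4 + b ^+ 4) (dE : d = o3 + d ^+ 4).
Hypotheses (o12 : o1 * o2 = (c * d) ^+ 2 + c ^+ 4 * a ^+ 4).
Hypotheses (o14 : o1 * o4 = (d * b) ^+ 2 + c ^+ 4 * b ^+ 4).
Hypotheses (o24 : o2 * o4 = (d * a) ^+ 2 + a ^+ 4 * b ^+ 4).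
Hypotheses (o13 : o1 * o3 = (b * a) ^+ 2 + c ^+ 4 * d ^+ 4).
Hypotheses (o23 : o2 * o3 = (c * b) ^+ 2 + a ^+ 4 * d ^+ 4).
Hypotheses (o43 : o4 * o3 = (c * a) ^+ 2 + b ^+ 4 * d ^+ 4).
Hypotheses (a0 : a != 0) (d1 : d != 1) (o1_0 : o1 != 0).

Let o1E : o1 = a + c ^+ 4. Proof. by rewrite {1}aE; ring2. Qed.
Let o2E : o2 = b + a ^+ 4. Proof. by rewrite {1}bE; ring2. Qed.
Let o4E : o4 = c + b ^+ 4. Proof. by rewrite {1}cE; ring2. Qed.
Let o3E : o3 = d + d ^+ 4. Proof. by rewrite {1}dE; ring2. Qed.

Let eq_addLL (x y z : L) : x = y -> z = x + y -> z = 0.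
Proof. by move=> -> ->; exact: addLL. Qed.

Lemma system_rels : theta_rels a b c d.
Proof.
split; split.
- by apply: (eq_addLL o24); rewrite o2E o4E /relA; ring2.
- by apply: (eq_addLL o14); rewrite o1E o4E /relA; ring2.
- by apply: (eq_addLL o12); rewrite o1E o2E /relA; ring2.
- by apply: (eq_addLL o23); rewrite o2E o3E /relB; ring2.
- by apply: (eq_addLL o43); rewrite o4E o3E /relB; ring2.
- by apply: (eq_addLL o13); rewrite o1E o3E /relB; ring2.
Qed.

Let rels := system_rels.
Let A1 : relA a b c d = 0. Proof. by case: rels => -[]. Qed.
Let A2 : relA b c a d = 0. Proof. by case: rels => -[]. Qed.
Let A3 : relA c a b d = 0. Proof. by case: rels => -[]. Qed.
Let B1 : relB a b c d = 0. Proof. by case: rels => _ []. Qed.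
Let B3 : relB c a b d = 0. Proof. by case: rels => _ []. Qed.

(* Multiplied by o1, the relation becomes the square of r = 0 below. *)
Lemma linear_rel : o1 * c ^+ 8 + o4 * b ^+ 8 = o2 * a ^+ 8.
Proof.
apply: add_eq0; apply: (mulfI o1_0); rewrite mulr0.
pose r := a * c ^+ 4 + c ^+ 8 + (c * d + c ^+ 2 * a ^+ 2) * a ^+ 4
          + (d * b + c ^+ 2 * b ^+ 2) * b ^+ 4.
have r0 : r = 0.
  suff -> : r = d ^+ 4 * relA a b c d + b ^+ 4 * relB a b c d
              + a ^+ 4 * relB b c a d + relC a b c d.
    by case: rels => _ [_ B2 _]; rewrite A1 B1 B2 (relC_eq0 rels d1) !mulr0 !addr0.
  by rewrite /r /relA /relB /relC; ring2.
transitivity ((o1 * c ^+ 4) ^+ 2 + (o1 * o4) * b ^+ 8 + (o1 * o2) * a ^+ 8); first by ring2.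
rewrite o14 o12 o1E -[RHS](expr0n _ 2) -r0 /r; ring2.
Qed.

(** The denominator a^4 has exponents divisible by 4, so residues modulo 4 can be read off the
    numerator; [divE4] does the same modulo 8. *)
Let divE (x y : L) : x * a ^+ 3 = y -> x / a = y * a^-1 ^+ 4.
Proof.
move=> <-; transitivity (x * (a * a^-1) ^+ 3 * a^-1); last by ring2.
by rewrite mulfV // expr1n mulr1.
Qed.

Let divE4 (x y z : L) : x * a ^+ 4 = y * a ^+ 8 + z -> x * a^-1 ^+ 4 = y + z * a^-1 ^+ 8.
Proof.
move=> E; apply: (mulIf (expf_neq0 8 a0)).
have aV : a^-1 * a = 1 by rewrite mulVf.
transitivity (x * a ^+ 4 * (a^-1 * a) ^+ 4); first by ring2.
rewrite aV E; transitivity (y * a ^+ 8 + z * (a^-1 * a) ^+ 8); last by ring2.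
by rewrite aV; ring2.
Qed.

(** In 1/a = (o1 + c^4)^3 / a^4 only the term c^12 of the numerator has residue 0 modulo 4. *)
Lemma inv_decomp : a^-1 = (c ^+ 3 / a) ^+ 4
  + (o1 * (c ^+ 4) ^+ 2 + o1 ^+ 2 * c ^+ 4 + o1 ^+ 3) * a^-1 ^+ 4.
Proof.
transitivity ((o1 + c ^+ 4) ^+ 3 * a^-1 ^+ 4); last by ring2.
by rewrite -[LHS]mul1r; apply: divE; rewrite mul1r -aE.
Qed.

(** The part of c a = (o4 + b^4) (o1 + c^4) of residue 1 modulo 4; by [wE] and [o43] its square is
    o3 o4. *)
Local Notation w := (b ^+ 4 * o1 + c ^+ 4 * o4).
Let wE : w = c * a + b ^+ 2 * d ^+ 2.
Proof.
apply: add_eq0; rewrite -A2 o1E o4E /relA; ring2.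
Qed.

(* In the decompositions below the summands are grouped by residue of exponents,
   modulo 4 in front of a^-1 ^+ 4 and modulo 8 in front of a^-1 ^+ 8. *)
Lemma cube_decomp : c ^+ 3 / a = (formG a b c d / a) ^+ 4 + w ^+ 3 * a^-1 ^+ 4
  + (o1 * (b ^+ 4) ^+ 3 * (c ^+ 4) ^+ 2 + o4 * (b ^+ 4) ^+ 2 * (c ^+ 4) ^+ 3
     + o4 ^+ 2 * o1 ^+ 3 * b ^+ 4 + o4 ^+ 3 * o1 ^+ 2 * c ^+ 4) * a^-1 ^+ 4
  + (o1 ^+ 2 * (b ^+ 4) ^+ 3 * c ^+ 4 + o4 * o1 * (b ^+ 4) ^+ 2 * (c ^+ 4) ^+ 2
     + o4 ^+ 2 * b ^+ 4 * (c ^+ 4) ^+ 3 + o4 ^+ 3 * o1 ^+ 3) * a^-1 ^+ 4.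
Proof.
set t1 := _ + o4 ^+ 3 * o1 ^+ 2 * c ^+ 4; set t2 := _ + o4 ^+ 3 * o1 ^+ 3.
have -> : (formG a b c d / a) ^+ 4 = formK a b c d ^+ 2 * a^-1 ^+ 4.
  by rewrite -(formG_sqr rels); ring2.
rewrite -!mulrDl; apply: divE.
transitivity ((o4 + b ^+ 4) ^+ 3 * (o1 + c ^+ 4) ^+ 3); first by rewrite -aE -cE.
(* Write c a = P + w + Q with P = b^4 c^4 and Q = o1 o4, of residues 0, 1, 2. The part of (c a)^3 of
   residue 0 is P^3 + Q w^2 + P Q^2. *)
have -> : formK a b c d ^+ 2 = b ^+ 12 * c ^+ 12 + (o1 * o4) * w ^+ 2
    + b ^+ 4 * c ^+ 4 * (o1 * o4) ^+ 2.
  by rewrite wE o14 /formK; ring2.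
by rewrite /t1 /t2; ring2.
Qed.

(** Each fourth power is split into its parts of residue 0 and 4 modulo 8. *)
Let b4E : b ^+ 4 = a ^+ 16 + o2 ^+ 4. Proof. by rewrite {1}bE; ring2. Qed.
Let c4E : c ^+ 4 = b ^+ 16 + o4 ^+ 4. Proof. by rewrite {1}cE; ring2. Qed.
Let a4E : a ^+ 4 = c ^+ 16 + o1 ^+ 4. Proof. by rewrite {1}aE; ring2. Qed.
Let d4E : d ^+ 4 = d ^+ 16 + o3 ^+ 4. Proof. by rewrite {1}dE; ring2. Qed.

(** As w^2 = o3 o4 has residue 2 modulo 8, the part of w^3 a^4 of residue 3 comes from the part of w
    a^4 of residue 1. By [linear_rel] the latter is d^8 o2 a^8, and a^8 cancels the denominator. *)
Lemma w_decomp : w ^+ 3 * a^-1 ^+ 4 = o2 * o3 * o4 * d ^+ 8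
  + o3 * o4 * (c ^+ 16 * (o1 * o2 ^+ 4 + o4 ^+ 5) + o1 ^+ 4 * (a ^+ 16 * o1 + b ^+ 16 * o4))
    * a^-1 ^+ 8.
Proof.
apply: divE4; set u5 := _ + o4 ^+ 5; set u1 := _ + b ^+ 16 * o4.
have wu : w = u1 + u5 by rewrite b4E c4E /u1 /u5; ring2.
have w2 : w ^+ 2 = o3 * o4 by rewrite wE [o3 * o4]mulrC o43; ring2.
have v : c ^+ 16 * u1 + o1 ^+ 4 * u5 = d ^+ 8 * (o2 * a ^+ 8).
  (* By [o12] and [o14] the two brackets are (c d)^8 and (d b)^8. *)
  transitivity (o1 * (c ^+ 16 * a ^+ 16 + (o1 * o2) ^+ 4)
    + o4 * (b ^+ 16 * c ^+ 16 + (o1 * o4) ^+ 4)); first by rewrite /u1 /u5; ring2.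
  by rewrite -linear_rel o12 o14; ring2.
transitivity (w ^+ 2 * ((u1 + u5) * (c ^+ 16 + o1 ^+ 4))).
  by rewrite -wu -a4E; ring2.
transitivity (w ^+ 2 * (c ^+ 16 * u1 + o1 ^+ 4 * u5
  + (c ^+ 16 * u5 + o1 ^+ 4 * u1))); first by ring2.
by rewrite v w2; ring2.
Qed.

(* w0, ..., w3 are the parts of d b^2 c of residue 0, ..., 3 modulo 4. *)
Local Notation w0 := (d ^+ 4 * a ^+ 8 * b ^+ 4 + o3 * o2 ^+ 2 * o4).
Local Notation w1 := (a ^+ 8 * (o3 * b ^+ 4 + d ^+ 4 * o4)).
Local Notation w2 := (o3 * o4 * a ^+ 8 + o2 ^+ 2 * d ^+ 4 * b ^+ 4).
Local Notation w3 := (o2 ^+ 2 * (o3 * b ^+ 4 + d ^+ 4 * o4)).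

(** As for w, the base of the square is the part of a b of residue 1 modulo 4. *)
Let sqr13 : (o1 * a ^+ 4 + o2 * c ^+ 4) ^+ 2 = o1 * o3.
Proof.
rewrite o13; have -> : o1 * a ^+ 4 + o2 * c ^+ 4 = b * a + c ^+ 2 * d ^+ 2.
  by apply: add_eq0; rewrite -A3 o1E o2E /relA; ring2.
by ring2.
Qed.

(** G/a = d (a b + c^2) + d b^2 c / a, so only the last term needs the denominator a^4. The summands
    of residue 3 modulo 4 are listed first. *)
Lemma form_decomp : formG a b c d / a =
  o1 * o2 * o3 + o3 * o4 ^+ 2
  + o1 * o3 * (b ^+ 4 * (d ^+ 4 * o1 + c ^+ 4 * o3)) * a^-1 ^+ 4
  + (d ^+ 4 * c ^+ 4 * a ^+ 4 + o3 * c ^+ 4 * a ^+ 4 + d ^+ 4 * o1 * a ^+ 4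
     + d ^+ 4 * c ^+ 4 * o2 + o3 * o1 * a ^+ 4 + o3 * c ^+ 4 * o2 + d ^+ 4 * o1 * o2)
  + (o3 * (b ^+ 4) ^+ 2 + d ^+ 4 * o4 ^+ 2 + d ^+ 4 * (b ^+ 4) ^+ 2)
  + (w0 * (c ^+ 4) ^+ 3 + w1 * o1 ^+ 3 + w2 * o1 ^+ 2 * c ^+ 4 + w3 * o1 * (c ^+ 4) ^+ 2)
    * a^-1 ^+ 4
  + (w1 * (c ^+ 4) ^+ 3 + w0 * o1 * (c ^+ 4) ^+ 2 + w2 * o1 ^+ 3 + w3 * o1 ^+ 2 * c ^+ 4)
    * a^-1 ^+ 4
  + (w2 * (c ^+ 4) ^+ 3 + w1 * o1 * (c ^+ 4) ^+ 2 + w0 * o1 ^+ 2 * c ^+ 4 + w3 * o1 ^+ 3)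
    * a^-1 ^+ 4.
Proof.
set n0 := w0 * _ + _ + _ + _; set n1 := w1 * _ + _ + _ + _; set n2 := w2 * _ + _ + _ + _.
pose n3 := w3 * (c ^+ 4) ^+ 3 + w2 * o1 * (c ^+ 4) ^+ 2 + w1 * o1 ^+ 2 * c ^+ 4 + w0 * o1 ^+ 3.
have n3E : n3 = o1 * o3 * (b ^+ 4 * (d ^+ 4 * o1 + c ^+ 4 * o3)).
  (* By [o12] the second summand is o1 o3 o4 c^4 d^4, which cancels the o4 term of the first. *)
  transitivity ((c ^+ 4 * (o3 * b ^+ 4 + d ^+ 4 * o4) + d ^+ 4 * b ^+ 4 * o1)
      * (o1 * a ^+ 4 + o2 * c ^+ 4) ^+ 2
    + o1 * o3 * o4 * ((o1 * o2) ^+ 2 + c ^+ 8 * a ^+ 8)).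
    by rewrite /n3; ring2.
  by rewrite sqr13 o12; ring2.
have aV : a * a^-1 = 1 by rewrite mulfV.
have -> : formG a b c d / a = d * (a * b + c ^+ 2) * (a * a^-1) + (d * b ^+ 2 * c) / a.
  by rewrite /formG; ring2.
rewrite aV -n3E (@divE (d * b ^+ 2 * c) (n0 + n1 + n2 + n3)).
  have -> : d * (a * b + c ^+ 2) = (o3 + d ^+ 4)
      * ((o1 + c ^+ 4) * (o2 + a ^+ 4) + (o4 + b ^+ 4) ^+ 2).
    by rewrite -aE -bE -cE -dE.
  by ring2.
transitivity ((o3 + d ^+ 4) * (o2 + a ^+ 4) ^+ 2 * (o4 + b ^+ 4) * (o1 + c ^+ 4) ^+ 3).
  by rewrite -aE -bE -cE -dE.
by rewrite /n0 /n1 /n2 /n3; ring2.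
Qed.

(* a^4 b^4 = p0 + p4 and d^4 o1 + c^4 o3 = m1 + m5, split by residue modulo 8. *)
Local Notation p0 := (c ^+ 16 * a ^+ 16 + o1 ^+ 4 * o2 ^+ 4).
Local Notation p4 := (c ^+ 16 * o2 ^+ 4 + a ^+ 16 * o1 ^+ 4).
Local Notation m1 := (d ^+ 16 * o1 + b ^+ 16 * o3).
Local Notation m5 := (o3 ^+ 4 * o1 + o4 ^+ 4 * o3).

(** The bracket is the part of a^4 b^4 (d^4 o1 + c^4 o3) of residue 1 modulo 8. The two sides add up
    to the square of a^2 [relE]. *)
Lemma quartic_rel : o3 * (p0 * m1 + p4 * m5) = a ^+ 16 * (o1 * o2).
Proof.
pose x := c ^+ 2 * d ^+ 3 + a * b * d + a * b * d ^+ 4.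
(* Both x and [formK] are rewritten as multiples of a, so that a^2 factors out of y. *)
have xE : x = a * b * (a * b ^+ 2 + d ^+ 4 + b * c ^+ 2).
  apply: add_eq0.
  suff -> : x + a * b * (a * b ^+ 2 + d ^+ 4 + b * c ^+ 2) =
      a * relB a b c d + d * relA c a b d + b * relB c a b d.
    by rewrite B1 A3 B3 !mulr0 !addr0.
  by rewrite /x /relA /relB; ring2.
have kE : formK a b c d = formK c a b d.
  rewrite -(formG_sqr rels) -(formG_sqr (theta_rels_cyc (theta_rels_cyc rels))).
  by rewrite /formG; ring2.
pose y := (a * b + c ^+ 2 * d ^+ 2) * x ^+ 2 + o3 * formK a b c d ^+ 2
          + a ^+ 8 * (c * d + c ^+ 2 * a ^+ 2).
have y0 : y = 0.
  have -> : y = a ^+ 2 * relE a b c d.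
    by rewrite /y kE xE o3E /relE /formK; ring2.
  by rewrite (relE_eq0 rels d1) mulr0.
have p0E : p0 = c ^+ 8 * d ^+ 8.
  transitivity (c ^+ 16 * a ^+ 16 + (o1 * o2) ^+ 4);
    [ring2|by rewrite o12; ring2].
have p4E : p4 = (o1 * o3) ^+ 2 by rewrite -sqr13; ring2.
transitivity (o1 * o3 * (c ^+ 8 * d ^+ 24 + (o1 * o3) ^+ 2 * o3 ^+ 4)
  + o3 ^+ 2 * (c ^+ 8 * d ^+ 8 * b ^+ 16 + (o1 * o4) ^+ 2 * (o4 * o3) ^+ 2)).
  by rewrite p0E p4E; ring2.
apply: add_eq0; rewrite -[RHS](expr0n _ 2) -[in RHS]y0 o12 o13 o14 o43 /y /x /formK.
by rewrite o3E; ring2.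
Qed.

(** After multiplication by a^4, the part of residue 3 modulo 8 is o1 times the left side of
    [quartic_rel], hence divisible by a^8. *)
Lemma quot_decomp :
  o1 * o3 * (b ^+ 4 * (d ^+ 4 * o1 + c ^+ 4 * o3)) * a^-1 ^+ 4 =
  o1 ^+ 2 * o2 * a ^+ 8 + o1 * o3 * (p0 * m5 + p4 * m1) * a^-1 ^+ 8.
Proof.
apply: divE4.
transitivity (o1 * (o3 * (p0 * m1 + p4 * m5)) + o1 * o3 * (p0 * m5 + p4 * m1)).
  by rewrite {1}b4E {1}d4E {1}c4E {1}a4E; ring2.
by rewrite quartic_rel; ring2.
Qed.

End System.
End CharTwo.

(** * Series of squares *)

(** P and Q may be infinite; intersecting them with the finite set D reduces to finite sums. *)
Lemma fsumU {T : choiceType} {V : nmodType} {D P Q : set T} {F : T -> V} :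
    finite_set D -> (forall x, ~ D x -> F x = 0) -> P `&` Q `<=` set0 ->
  \sum_(x \in P `|` Q) F x = \sum_(x \in P) F x + \sum_(x \in Q) F x.
Proof.
move=> Dfin F0 PQ.
have cut A : \sum_(x \in A) F x = \sum_(x \in A `&` D) F x.
  by apply/esym/fsbig_widen => [x []//|x [Ax nADx]]; apply: F0 => Dx; apply: nADx.
rewrite (cut P) (cut Q) cut setIUl fsbigU0//; try exact: finite_setIr.
by move=> x [[Px _] [Qx _]]; exact: PQ.
Qed.

Definition box (B : int) : set int := [set n | `|n| <= B].

Lemma finite_box B : finite_set (box B).
Proof.
apply: (@sub_finite_set _ _ ((Posz @` `I_`|B|.+1) `|` ((fun n => - Posz n) @` `I_`|B|.+1))).
  move=> n; rewrite /box /= => nB; have [n0|n0] := leP 0 n; [left|right];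
  by exists `|n|%N => /=; lia.
by rewrite finite_setU; split; apply: finite_image; exact: finite_II.
Qed.

(** [theta_coef] for an arbitrary index set, so that even and odd parts are series of the same
    kind. *)
Definition qs_coef (A : set int) (k : int) : 'F_2 := \sum_(n \in A) ((k == n ^+ 2)%:R : 'F_2).

Lemma sqr_box (n k B : int) : n ^+ 2 <= k -> k <= B -> box B n.
Proof. by rewrite /box /=; nia. Qed.

Fact qs_low A : low 0 (qs_coef A).
Proof.
move=> k k0; rewrite /qs_coef fsbig1// => n _.
by rewrite lt_eqF//; apply: lt_le_trans k0 (sqr_ge0 n).
Qed.

Definition qs (A : set int) : laurent 'F_2 := mk_laurent (ex_intro _ 0 (@qs_low A)).

Lemma qs_coef_box A k B : k <= B ->
  qs_coef A k = \sum_(n \in A `&` box B) ((k == n ^+ 2)%:R : 'F_2).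
Proof.
move=> kB; apply/esym/fsbig_widen => [n []//|n [An nAB]] /=; case: eqP => // kn.
by case: nAB; split=> //; apply: (@sqr_box n k) => //; rewrite kn.
Qed.

Lemma fsum_ind1 (D : set int) (i : int) : D i -> forall F : int -> 'F_2,
  \sum_(x \in D) (x == i)%:R * F x = F i.
Proof.
move=> Di F; rewrite -(@fsbig_widen _ _ _ _ [set i] D); first by rewrite fsbig_set1 eqxx mul1r.
  by move=> x ->.
by move=> x [_ /eqP/negPf /= ->]; rewrite mul0r.
Qed.

(** All indices are confined to the box of radius |k|, where the finite sums can be exchanged. *)
Lemma lcoef_qsM A B k :
  lcoef (qs A * qs B) k = \sum_(p \in A `*` B) ((k == p.1 ^+ 2 + p.2 ^+ 2)%:R : 'F_2).
Proof.
pose W := box `|k|.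
rewrite lcoefM -(@fsbig_widen _ _ _ _ W) => [|//|i [_ iW]]; last first.
  rewrite /=; have [i0|i0] := ltP i 0; first by rewrite qs_low ?mul0r.
  by rewrite [X in _ * X]qs_low ?mulr0//; move: iW; rewrite /W /box /=; lia.
transitivity (\sum_(i \in W) \sum_(p \in (A `&` W) `*` (B `&` W))
    ((i == p.1 ^+ 2)%:R * (k - i == p.2 ^+ 2)%:R : 'F_2)).
  apply: eq_fsbigr => i; rewrite inE => iW /=.
  have [i0|i0] := ltP i 0.
    rewrite qs_low ?mul0r// fsbig1// => p _.
    by rewrite lt_eqF ?mul0r//; apply: lt_le_trans i0 (sqr_ge0 _).
  rewrite (@qs_coef_box A i `|k|) ?(@qs_coef_box B (k - i) `|k|); first last.
  - by move: iW; rewrite /W /box /=; lia.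
  - by lia.
  rewrite mulr_fsuml.
  under eq_fsbigr do rewrite mulr_fsumr.
  by rewrite pair_fsbig//; apply: finite_setIr; exact: finite_box.
rewrite exchange_fsbig; [|exact: finite_box
  |by apply: finite_setX; apply: finite_setIr; exact: finite_box].
transitivity (\sum_(p \in (A `&` W) `*` (B `&` W)) ((k == p.1 ^+ 2 + p.2 ^+ 2)%:R : 'F_2)).
  apply: eq_fsbigr => p _.
  have [pk|pk] := leP (p.1 ^+ 2) `|k|; last first.
    rewrite fsbig1 => [|i iW].
      by case: eqP => // kE; have := sqr_ge0 p.2; nia.
    by case: eqP => [iE|]; rewrite ?mul0r//; move: iW; rewrite /W /box /=; nia.
  rewrite fsum_ind1.
    by congr (_%:R); congr nat_of_bool; apply/eqP/eqP; lia.
  by rewrite /W /box /= ger0_norm ?sqr_ge0.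
apply: fsbig_widen => [p [[] ? _ [] ? _]//|p [[/= Ap Bp] pAB]] /=; case: eqP => // kE; case: pAB.
have := sqr_ge0 p.1; have := sqr_ge0 p.2.
by split; split=> //=; rewrite /W /box /=; nia.
Qed.

(** * The Frobenius map on series over the field with two elements *)

Lemma F2_cases (c : 'F_2) : (c = 0) + (c = 1).
Proof. by case: c => [[|[|]]] // i; [left|right]; apply: val_inj. Qed.

Lemma addF2 (c : 'F_2) : c + c = 0.
Proof. by case: (F2_cases c) => ->; rewrite ?addr0//; apply: val_inj. Qed.

Lemma coef_sqrp (p : {poly 'F_2}) m : (p * p)`_m = if odd m then 0 else p`_m./2.
Proof.
elim/poly_ind: p m => [|p c IH] m; first by rewrite mul0r !coef0 if_same.
have -> : (p * 'X + c%:P) * (p * 'X + c%:P) = p * p * 'X^2 + c%:P.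
  have -> : (p * 'X + c%:P) * (p * 'X + c%:P) =
      p * p * 'X^2 + (c * c)%:P + (p * 'X * c%:P + p * 'X * c%:P).
    rewrite mulrDl !mulrDr polyCM expr2 [c%:P * (p * 'X)]mulrC -!addrA; congr (_ + _).
      by rewrite !mulrA -[p * 'X * p]mulrA ['X * p]mulrC !mulrA.
    by rewrite addrA [RHS]addrC.
  have -> : p * 'X * c%:P + p * 'X * c%:P = 0.
    by apply/polyP => i; rewrite coefD coef0 addF2.
  by rewrite addr0; case: (F2_cases c) => ->; rewrite ?mulr0 ?mulr1.
rewrite !coefD coefMXn coefMX !coefC; case: m => [|[|m]] //=; rewrite ?addr0//.
by rewrite IH subSS subn1 /= negbK; case: odd; rewrite ?addr0.
Qed.

Lemma lcoef_sqr (f : laurent 'F_2) k :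
  lcoef (f ^+ 2) k = if (2 %| k)%Z then lcoef f (k %/ 2)%Z else 0.
Proof.
have [N fN] := lcoefP f; rewrite expr2 -[lcoef (f * f)]/(conv (lcoef f) (lcoef f)).
have [kN|Nk] := ltP k (N + N).
  rewrite (conv_low fN fN)//; case: ifP => // k2; rewrite fN//; lia.
have -> : k = N + N + (absz (k - (N + N))%R)%:Z by lia.
set m := absz _; rewrite (@conv_trunc _ _ _ m.+1)// coef_sqrp coef_poly.
have -> : (2 %| N + N + m%:Z)%Z = ~~ odd m by lia.
case: ifP => // mo /=; rewrite ifT; last by rewrite ltnS; lia.
by congr (lcoef f _); lia.
Qed.

Lemma lcoef_exp4 (f : laurent 'F_2) k :
  lcoef (f ^+ 4) k = if (4 %| k)%Z then lcoef f (k %/ 4)%Z else 0.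
Proof.
rewrite (exprM f 2 2) !lcoef_sqr.
case: ifP => k2; last by rewrite ifF//; lia.
have -> : (2 %| k %/ 2)%Z = (4 %| k)%Z by lia.
by case: ifP => // k4; congr (lcoef f _); lia.
Qed.

(** * Even and odd parts of theta series, and their products *)

Definition cls (i : int) : set int := [set n | (n = i %[mod 9])%Z].
Definition odds : set int := [set n | (n = 1 %[mod 2])%Z].

Lemma theta_qs i : theta i = qs (cls i). Proof. exact/laurentP. Qed.

Definition oddtheta i := qs (cls i `&` odds).

(** Frobenius turns x^(n^2) into x^((2n)^2), and n -> 2n maps the class of i onto the even members
    of the class of 2i. *)
Lemma theta_exp4 i : theta i ^+ 4 = qs (cls (2 * i) `&` ~` odds).
Proof.
apply/laurentP => k; rewrite lcoef_exp4 /= /qs_coef.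
rewrite (reindex_fsbig (fun n => 2 * n) (cls i)); last first.
  split=> [n|n m _ _|n] /=; rewrite /cls /odds /=; [lia|lia|].
  by move=> [ni n2]; exists (n %/ 2)%Z => /=; lia.
case: ifP => k4; last first.
  by rewrite fsbig1// => n _; case: eqP => // kE; move: k4; nia.
rewrite /theta_coef; apply: eq_fsbigr => n _.
by congr (_%:R); congr nat_of_bool; apply/eqP/eqP; nia.
Qed.

Lemma qsU A B : A `&` B `<=` set0 -> qs (A `|` B) = qs A + qs B.
Proof.
move=> AB; apply/laurentP => k /=; apply: (fsumU (finite_box k)) => // n nk.
by case: eqP => // kE; case: nk; apply: (@sqr_box n k) => //; rewrite kE.
Qed.

Lemma thetaE i : theta (2 * i) = oddtheta (2 * i) + theta i ^+ 4.
Proof.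
rewrite theta_exp4 theta_qs -qsU.
  by rewrite -setIUr setUv setIT.
by move=> x [[_ ox] [_ /(_ ox)]].
Qed.

(** Pairs of equal parity in the classes of 2i and 2j are the pairs (m + n, m - n) with m in the
    class of i + j and n in that of i - j, because 2 is invertible modulo 9. The odd pairs and the
    even pairs give the two products. *)
Lemma oddtheta_mul (i j : int) :
  oddtheta (2 * i) * oddtheta (2 * j) =
  (theta (i + j) * theta (i - j)) ^+ 2 + theta i ^+ 4 * theta j ^+ 4.
Proof.
suff: (theta (i + j) * theta (i - j)) ^+ 2 =
    oddtheta (2 * i) * oddtheta (2 * j) + theta i ^+ 4 * theta j ^+ 4.
  move=> ->; rewrite -addrA -[LHS]addr0; congr (_ + _).
  by apply/laurentP => k; rewrite !lcoefD addF2.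
apply/laurentP => k; rewrite lcoefD !theta_exp4 lcoef_sqr !theta_qs !lcoef_qsM.
pose par (A : set int) : set (int * int) := (cls (2 * i) `&` A) `*` (cls (2 * j) `&` A).
rewrite -[RHS](@fsumU _ _ (box k `*` box k) (par odds) (par (~` odds))); first last.
- by move=> p [[[_ op] _] [[_ /(_ op)]]].
- move=> p pk; case: eqP => // kE; case: pk.
  by split; apply: (@sqr_box _ k) => //; rewrite kE ?lerDl ?lerDr sqr_ge0.
- by apply: finite_setX; exact: finite_box.
rewrite [RHS](reindex_fsbig (fun p : int * int => (p.1 + p.2, p.1 - p.2))
  (cls (i + j) `*` cls (i - j))); last first.
  split=> [[m n]|[m n] [m' n'] _ _|[u v]]; rewrite /par /cls /odds /setU /setI /setX /setC /=.
  - move=> [mi nj]; case: (boolP (2 %| m + n)%Z) => mn; [right|left]; lia.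
  - by case=> mn mn'; congr (_, _); lia.
  - move=> uv; have [m um] : exists m, u + v = 2 * m by exists ((u + v) %/ 2)%Z; case: uv; lia.
    exists (m, u - m) => /=; last by congr (_, _); lia.
    by split; case: uv; lia.
have sq2 (m n : int) : (m + n) ^+ 2 + (m - n) ^+ 2 = 2 * (m ^+ 2 + n ^+ 2) by nia.
case: ifP => k2 /=.
  apply: eq_fsbigr => p _; rewrite sq2; congr (_%:R); congr nat_of_bool.
  by move: (_ + _) => x; apply/eqP/eqP; lia.
by rewrite fsbig1// => p _; rewrite sq2; case: eqP => // kE; move: k2; rewrite kE; lia.
Qed.

(** * Sections of homogeneous series *)

Section Homogeneous.
Variable K : fieldType.
Implicit Types (f g : laurent K) (q : nat) (j k : int).

Definition homog q j f := forall n, (n != j %[mod q])%Z -> lcoef f n = 0.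

Lemma homogD q j k f g : homog q j f -> homog q k g -> (k == j %[mod q])%Z ->
  homog q j (f + g).
Proof. by move=> fj gk /eqP kj n nj; rewrite lcoefD fj // gk ?addr0 ?kj. Qed.

Lemma homogM q j k f g : homog q j f -> homog q k g -> homog q (j + k) (f * g).
Proof.
move=> fj gk n njk; rewrite lcoefM fsbig1 // => i _.
have [ij|ij] := boolP (i == j %[mod q])%Z; last by rewrite fj ?mul0r.
rewrite [X in _ * X]gk ?mulr0 //; apply: contraNN njk => /eqP nik.
have nE : n = i + (n - i) by rewrite addrC subrK.
by rewrite nE -modzDm nik (eqP ij) modzDm.
Qed.

Lemma homogX q j f m : homog q j f -> homog q (j *+ m) (f ^+ m).
Proof.
move=> fj; elim: m => [|m IH]; last by rewrite exprS mulrS; apply: homogM.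
by move=> n; rewrite expr0 lcoef1; case: (n =P 0) => // ->; rewrite mulr0n eqxx.
Qed.

Lemma lcoef_sect q (j : nat) f n :
  lcoef (sect q j f) n = if (n == j %[mod q])%Z then lcoef f n else 0.
Proof. by []. Qed.

Lemma sectD q (j : nat) f g : sect q j (f + g) = sect q j f + sect q j g.
Proof.
by apply/laurentP => n; rewrite lcoefD !lcoef_sect lcoefD; case: ifP; rewrite ?addr0.
Qed.

Lemma sect_homog q (j : nat) k f : homog q k f -> (k == j %[mod q])%Z -> sect q j f = f.
Proof.
move=> fk /eqP kj; apply/laurentP => n; rewrite lcoef_sect.
by case: ifPn => // nj; rewrite fk // kj.
Qed.

Lemma sect_homog0 q (j : nat) k f : homog q k f -> (k != j %[mod q])%Z -> sect q j f = 0.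
Proof.
move=> fk kj; apply/laurentP => n; rewrite lcoef_sect.
by case: eqP => // nj; rewrite fk // nj eq_sym.
Qed.

Lemma sect_sect q q' (j j' : nat) f : (q' %| q)%N -> (j = j' %[mod q'])%N ->
  sect q j (sect q' j' f) = sect q j f.
Proof.
move=> q'q jj'; apply/laurentP => n; rewrite !lcoef_sect; case: ifP => // nj.
rewrite ifT //; have /eqP -> : (n == j %[mod q'])%Z; last by rewrite !modz_nat jj'.
by move: nj; rewrite !eqz_mod_dvd; apply: dvdz_trans; rewrite dvdzE.
Qed.

End Homogeneous.

Lemma lcoef_exp8 (f : laurent 'F_2) k :
  lcoef (f ^+ 8) k = if (8 %| k)%Z then lcoef f (k %/ 8)%Z else 0.
Proof.
rewrite (exprM f 4 2) lcoef_sqr lcoef_exp4.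
case: ifP => k2; last by rewrite ifF //; lia.
have -> : (4 %| k %/ 2)%Z = (8 %| k)%Z by lia.
by case: ifP => // k8; congr (lcoef f _); lia.
Qed.

Lemma homog_exp4 (f : laurent 'F_2) : homog 4 0 (f ^+ 4).
Proof. by move=> n n4; rewrite lcoef_exp4 ifF //; lia. Qed.

Lemma homog_exp8 (f : laurent 'F_2) : homog 8 0 (f ^+ 8).
Proof. by move=> n n8; rewrite lcoef_exp8 ifF //; lia. Qed.

Lemma homog_exp16 (f : laurent 'F_2) : homog 8 0 (f ^+ 16).
Proof. by rewrite (exprM f 2 8); exact: homog_exp8. Qed.

Lemma sect_exp4 q (j : nat) (f : laurent 'F_2) :
  sect (4 * q) (4 * j) (f ^+ 4) = sect q j f ^+ 4.
Proof.
apply/laurentP => k; rewrite lcoef_sect !lcoef_exp4.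
case: ifP; case: ifP => // k4; rewrite lcoef_sect.
  move=> kj; rewrite ifT //; move: kj; rewrite !eqz_mod_dvd !PoszM.
  by rewrite -{1}(divzK k4) mulrC -mulrBr dvdz_mul2l.
move=> kj; rewrite ifF //; apply: contraFF kj; rewrite !eqz_mod_dvd !PoszM.
by rewrite -{2}(divzK k4) [_ * 4]mulrC -mulrBr dvdz_mul2l.
Qed.

Lemma char2_laurent : 1 + 1 = 0 :> laurent 'F_2.
Proof. by apply/laurentP => n; rewrite lcoefD addF2. Qed.

Lemma theta_mod9 (i j : int) : (i = j %[mod 9])%Z -> theta i = theta j.
Proof.
by move=> ij; rewrite !theta_qs; congr qs; rewrite /cls predeqE => n /=; rewrite ij.
Qed.

Lemma thetaN (i : int) : theta (- i) = theta i.
Proof.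
apply/laurentP => k; rewrite /= /theta_coef.
rewrite (reindex_fsbig (fun n => - n) (cls i)); last first.
  split=> [n|n m _ _|n] /=; rewrite /cls /=; [lia|lia|].
  by move=> ni; exists (- n); lia.
by apply: eq_fsbigr => n _; rewrite sqrrN.
Qed.

Lemma theta_mod9N (i j : int) : (i = - j %[mod 9])%Z -> theta i = theta j.
Proof. by move=> /theta_mod9 ->; exact: thetaN. Qed.

Lemma homog_oddtheta i : homog 8 1 (oddtheta i).
Proof.
move=> k k1; rewrite /= /qs_coef fsbig1 // => n [_]; rewrite /odds /= => n1.
case: eqP => // kE; move: k1; rewrite kE.
have [s [r ns]] : exists s r, n = 4 * s + r /\ (r = 1 \/ r = 3).
  by exists (n %/ 4)%Z, (n %% 4)%Z; lia.
have [t ->] : exists t, n ^+ 2 = 8 * t + 1.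
  by case: ns => -> [] ->; [exists (2 * s ^+ 2 + s)|exists (2 * s ^+ 2 + 3 * s + 1)]; nia.
lia.
Qed.

Lemma homog4 (K : fieldType) (j : int) (f : laurent K) : homog 8 j f -> homog 4 j f.
Proof. by move=> f8 n n4; apply: f8; lia. Qed.

(** The residue is computed from the shape of the expression. Fourth, eighth and sixteenth powers
    precede the general power rule because their bases need not be homogeneous. *)
Ltac weight := lazymatch goal with
  | |- homog _ _ (@Algebra.add _ _ _) => eapply homogD; [weight|weight|exact isT]
  | |- homog _ _ (@GRing.mul _ _ _) => eapply homogM; weight
  | |- homog 4 _ (@GRing.exp _ _ 4) => exact (@homog_exp4 _)
  | |- homog 4 _ (@GRing.exp _ _ 8) => exact (homog4 (@homog_exp8 _))
  | |- homog 8 _ (@GRing.exp _ _ 8) => exact (@homog_exp8 _)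
  | |- homog 8 _ (@GRing.exp _ _ 16) => exact (@homog_exp16 _)
  | |- homog _ _ (@GRing.exp _ _ _) => eapply homogX; weight
  | H : homog ?q _ ?f |- homog ?q _ ?f => exact H
  end.

Ltac take_sect := rewrite ?mulrDl !sectD; repeat match goal with
  | |- context [sect ?q ?j ?f] => first
    [ have -> : sect q j f = 0; [eapply sect_homog0; [weight|exact isT]|]
    | have -> : sect q j f = f; [eapply sect_homog; [weight|exact isT]|] ]
  end; rewrite ?(addr0, add0r).

(** * The sections of 1/a, c^3/a and G/a *)

Section Sections.
Variables a b c d o1 o2 o3 o4 : laurent 'F_2.
Hypotheses (aE : a = o1 + c ^+ 4) (bE : b = o2 + a ^+ 4).
Hypotheses (cE : c = o4 + b ^+ 4) (dE : d = o3 + d ^+ 4).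
Hypotheses (o12 : o1 * o2 = (c * d) ^+ 2 + c ^+ 4 * a ^+ 4).
Hypotheses (o14 : o1 * o4 = (d * b) ^+ 2 + c ^+ 4 * b ^+ 4).
Hypotheses (o24 : o2 * o4 = (d * a) ^+ 2 + a ^+ 4 * b ^+ 4).
Hypotheses (o13 : o1 * o3 = (b * a) ^+ 2 + c ^+ 4 * d ^+ 4).
Hypotheses (o23 : o2 * o3 = (c * b) ^+ 2 + a ^+ 4 * d ^+ 4).
Hypotheses (o43 : o4 * o3 = (c * a) ^+ 2 + b ^+ 4 * d ^+ 4).
Hypotheses (a0 : a != 0) (d1 : d != 1) (o1_0 : o1 != 0).
Hypotheses (h1 : homog 8 1 o1) (h2 : homog 8 1 o2).
Hypotheses (h3 : homog 8 1 o3) (h4 : homog 8 1 o4).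

(* Not referred to by name: the tactic weight finds these in the context. *)
Let g1 : homog 4 1 o1 := homog4 h1.
Let g2 : homog 4 1 o2 := homog4 h2.
Let g3 : homog 4 1 o3 := homog4 h3.
Let g4 : homog 4 1 o4 := homog4 h4.

Lemma sect_inv : sect 4 0 (1 / a) = (c ^+ 3 / a) ^+ 4.
Proof.
rewrite div1r [in LHS](inv_decomp char2_laurent aE a0).
by take_sect.
Qed.

Lemma sect_cube0 : sect 4 0 (c ^+ 3 / a) = (formG a b c d / a) ^+ 4.
Proof.
rewrite (cube_decomp char2_laurent aE bE cE dE o12 o14 o24 o13 o23 o43 a0).
by take_sect.
Qed.

Lemma sect_cube3 : sect 8 3 (c ^+ 3 / a) = o2 * o3 * o4 * d ^+ 8.
Proof.
(* Taking residue 3 modulo 4 first leaves only w^3 / a^4, which is then split modulo 8. *)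
rewrite -(@sect_sect _ 8 4 3 3) //.
rewrite (cube_decomp char2_laurent aE bE cE dE o12 o14 o24 o13 o23 o43 a0).
have -> : sect 4 3 ((formG a b c d / a) ^+ 4 + (b ^+ 4 * o1 + c ^+ 4 * o4) ^+ 3 * a^-1 ^+ 4
  + (o1 * (b ^+ 4) ^+ 3 * (c ^+ 4) ^+ 2 + o4 * (b ^+ 4) ^+ 2 * (c ^+ 4) ^+ 3
     + o4 ^+ 2 * o1 ^+ 3 * b ^+ 4 + o4 ^+ 3 * o1 ^+ 2 * c ^+ 4) * a^-1 ^+ 4
  + (o1 ^+ 2 * (b ^+ 4) ^+ 3 * c ^+ 4 + o4 * o1 * (b ^+ 4) ^+ 2 * (c ^+ 4) ^+ 2
     + o4 ^+ 2 * b ^+ 4 * (c ^+ 4) ^+ 3 + o4 ^+ 3 * o1 ^+ 3) * a^-1 ^+ 4)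
  = (b ^+ 4 * o1 + c ^+ 4 * o4) ^+ 3 * a^-1 ^+ 4 by take_sect.
rewrite (w_decomp char2_laurent aE bE cE dE o12 o14 o24 o13 o23 o43 a0 d1 o1_0).
by take_sect.
Qed.

Lemma sect_form : sect 8 3 (formG a b c d / a) =
  o1 * o2 * o3 + o3 * o4 ^+ 2 + o1 ^+ 2 * o2 * a ^+ 8.
Proof.
rewrite -(@sect_sect _ 8 4 3 3) //.
rewrite (form_decomp char2_laurent aE bE cE dE o12 o14 o24 o13 o23 o43 a0).
set f := (X in sect 8 3 X).
have -> : f = o1 * o2 * o3 + o3 * o4 ^+ 2
  + o1 * o3 * (b ^+ 4 * (d ^+ 4 * o1 + c ^+ 4 * o3)) * a^-1 ^+ 4.
  by rewrite /f; take_sect.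
rewrite (quot_decomp char2_laurent aE bE cE dE o12 o14 o24 o13 o23 o43 a0 d1).
by take_sect.
Qed.
End Sections.

(** * The theta series modulo 9 *)

Lemma ringSP x : (forall A : set (laurent 'F_2), subring_closed [in A] ->
  [set theta 1; theta 2; theta 3; theta 4] `<=` A -> A x) -> ringS x.
Proof. by move=> xA A [/= Aring Agen]; exact: xA. Qed.

Lemma ringSD x y : ringS x -> ringS y -> ringS (x + y).
Proof.
move=> xS yS; apply: ringSP => A Aring Agen.
have {}xS : x \in A by rewrite inE; apply: xS.
have {}yS : y \in A by rewrite inE; apply: yS.
by have := (GRing.zmod_closedD (GRing.subring_closedB Aring)).2 _ _ xS yS; rewrite inE.
Qed.

Lemma ringSM x y : ringS x -> ringS y -> ringS (x * y).
Proof.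
move=> xS yS; apply: ringSP => A Aring Agen.
have {}xS : x \in A by rewrite inE; apply: xS.
have {}yS : y \in A by rewrite inE; apply: yS.
by case: Aring => _ _ /(_ _ _ xS yS); rewrite inE.
Qed.

Lemma ringSX x n : ringS x -> ringS (x ^+ n).
Proof.
move=> xS; elim: n => [|n IH]; last by rewrite exprS; apply: ringSM.
by apply: ringSP => A [A1 _ _] _; rewrite expr0; move: A1; rewrite inE.
Qed.

Lemma ringS_theta (i : int) : ~~ (9 %| i)%Z -> ringS (theta i).
Proof.
move=> i9; apply: ringSP => A _ Agen.
have [j ij jA] : exists2 j, (i = j %[mod 9])%Z \/ (i = - j %[mod 9])%Z
    & j \in [:: 1; 2; 3; 4].
  (* Up to sign, every nonzero class modulo 9 is represented by 1, 2, 3 or 4. *)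
  exists (Num.min (i %% 9)%Z (9 - (i %% 9)%Z)); first by lia.
  by rewrite !inE; lia.
have -> : theta i = theta j by case: ij => [/theta_mod9|/theta_mod9N].
by apply: Agen; move: jA; rewrite !inE /= => /or4P[] /eqP ->; tauto.
Qed.

(** * The quadruple [i], [2i], [4i], [3i] for i prime to 3 *)

Section Theta.
Variable i : int.
Hypothesis i3 : ~~ (3 %| i)%Z.

Let a := theta i.
Let b := theta (2 * i).
Let c := theta (4 * i).
Let d := theta (3 * i).
(** The argument 2 (4i) is -i modulo 9, and 2 (3i) is -3i. The doubled form is what [thetaE] and
    [oddtheta_mul] expect. *)
Let o1 := oddtheta (2 * (4 * i)).
Let o2 := oddtheta (2 * i).
Let o3 := oddtheta (2 * (3 * i)).
Let o4 := oddtheta (2 * (2 * i)).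

Let aE : a = o1 + c ^+ 4.
Proof. by rewrite -thetaE; apply: theta_mod9N; lia. Qed.
Let bE : b = o2 + a ^+ 4. Proof. by rewrite -thetaE. Qed.
Let cE : c = o4 + b ^+ 4.
Proof. by rewrite -thetaE; apply: theta_mod9; lia. Qed.
Let dE : d = o3 + d ^+ 4.
Proof. by rewrite -thetaE; apply: theta_mod9N; lia. Qed.

Let o12 : o1 * o2 = (c * d) ^+ 2 + c ^+ 4 * a ^+ 4.
Proof.
rewrite oddtheta_mul (@theta_mod9N (4 * i + i) (4 * i)); last by lia.
by rewrite (@theta_mod9 (4 * i - i) (3 * i)); last by lia.
Qed.
Let o14 : o1 * o4 = (d * b) ^+ 2 + c ^+ 4 * b ^+ 4.
Proof.
rewrite oddtheta_mul (@theta_mod9N (4 * i + 2 * i) (3 * i)); last by lia.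
by rewrite (@theta_mod9 (4 * i - 2 * i) (2 * i)); last by lia.
Qed.
Let o24 : o2 * o4 = (d * a) ^+ 2 + a ^+ 4 * b ^+ 4.
Proof.
rewrite oddtheta_mul (@theta_mod9 (i + 2 * i) (3 * i)); last by lia.
by rewrite (@theta_mod9N (i - 2 * i) i); last by lia.
Qed.
Let o13 : o1 * o3 = (b * a) ^+ 2 + c ^+ 4 * d ^+ 4.
Proof.
rewrite oddtheta_mul (@theta_mod9N (4 * i + 3 * i) (2 * i)); last by lia.
by rewrite (@theta_mod9 (4 * i - 3 * i) i); last by lia.
Qed.
Let o23 : o2 * o3 = (c * b) ^+ 2 + a ^+ 4 * d ^+ 4.
Proof.
rewrite oddtheta_mul (@theta_mod9 (i + 3 * i) (4 * i)); last by lia.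
by rewrite (@theta_mod9N (i - 3 * i) (2 * i)); last by lia.
Qed.
Let o43 : o4 * o3 = (c * a) ^+ 2 + b ^+ 4 * d ^+ 4.
Proof.
rewrite oddtheta_mul (@theta_mod9N (2 * i + 3 * i) (4 * i)); last by lia.
by rewrite (@theta_mod9N (2 * i - 3 * i) i); last by lia.
Qed.

Let a0 : a != 0. Proof. by apply: theta_neq0; lia. Qed.

(** The coefficient of d at the nonzero exponent (3i)^2 is 1. *)
Let d1 : d != 1.
Proof.
have i9 : ~~ (9%:Z %| 3 * i)%Z by lia.
apply/eqP => dE1; have := lcoef_theta_sqr i9.
rewrite -/d dE1 lcoef1 expf_eq0 /= => /eqP; rewrite (_ : 3 * i == 0 = false) //; lia.
Qed.

(** Otherwise a = c^4 has only exponents divisible by 4, while it has coefficient 1 at n^2 for an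
    odd n in the class of i. *)
Let o1_0 : o1 != 0.
Proof.
have [n ni n2] : exists2 n, (n = i %[mod 9])%Z & (n = 1 %[mod 2])%Z.
  by case: (boolP (2 %| i)%Z) => i2; [exists (i + 9)|exists i]; lia.
apply/eqP => o10; have n9 : ~~ (9%:Z %| n)%Z by lia.
have := lcoef_theta_sqr n9; rewrite (theta_mod9 ni) -/a aE o10 add0r lcoef_exp4.
rewrite ifF // (_ : n = 2 * (n %/ 2)%Z + 1); last by lia.
move: (n %/ 2)%Z => m; apply/negP => m4; nia.
Qed.

Lemma ringS_sect : ringS (sect 32 12 (1 / a)) /\ ringS (sect 128 48 (1 / a)).
Proof.
have h (j : int) : homog 8 1 (oddtheta j) := @homog_oddtheta j.
have inv := sect_inv aE a0 (h _).
have S3 := sect_cube3 aE bE cE dE o12 o14 o24 o13 o23 o43 a0 d1 o1_0 (h _) (h _) (h _) (h _).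
have S0 := sect_cube0 aE bE cE dE o12 o14 o24 o13 o23 o43 a0 (h _) (h _).
have SG := sect_form aE bE cE dE o12 o14 o24 o13 o23 o43 a0 d1 (h _) (h _) (h _) (h _).
have [Sa Sb Sc Sd] : [/\ ringS a, ringS b, ringS c & ringS d].
  by split; apply: ringS_theta; lia.
have odd_ring x y z : ringS x -> ringS y -> x = z + y ^+ 4 -> ringS z.
  move=> xS yS xE; have -> : z = x + y ^+ 4.
    by rewrite xE -addrA (addLL char2_laurent) addr0.
  by apply: ringSD => //; apply: ringSX.
have So1 := odd_ring _ _ _ Sa Sc aE; have So2 := odd_ring _ _ _ Sb Sa bE.
have So4 := odd_ring _ _ _ Sc Sb cE; have So3 := odd_ring _ _ _ Sd Sd dE.
split.
  rewrite -(@sect_sect _ 32 4 12 0) // inv (@sect_exp4 8 3) S3.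
  by apply: ringSX; apply: ringSM; [do ?apply: ringSM|apply: ringSX].
(* Two descents by Frobenius, since (128, 48) = 4 (32, 12) and (32, 12) = 4 (8, 3). *)
rewrite -(@sect_sect _ 128 4 48 0) // inv (@sect_exp4 32 12).
rewrite -(@sect_sect _ 32 4 12 0) // S0 (@sect_exp4 8 3) SG.
by do 2 apply: ringSX; do ?[apply: ringSD|apply: ringSM|apply: ringSX].
Qed.

End Theta.

Theorem theorem6p5 (r : int) (hr : r \in [:: 1; 2; 4]) :
  ringS (sect 32 12 (1 / theta r)) /\ ringS (sect 128 48 (1 / theta r)).
Proof.
by apply: ringS_sect; move: hr; rewrite !inE => /or3P[] /eqP ->.
Qed.
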